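(* Let $S_{1,1}$ be the compact oriented surface of genus $1$ with one boundary component, with $\pi_1(S_{1,1})$ free on $\gamma_1,\gamma_2$ represented by curves that intersect at one point, so that the peripheral element is $\gamma_1\gamma_2\gamma_1^{-1}\gamma_2^{-1}$. Let $\rho_0\colon\pi_1(S_{1,1})\to\mathrm{SL}_2(\mathbb C)$ be a good, $\partial$-regular representation such that $t_{12}(\rho_0)\ne t_{1\bar2}(\rho_0)$. Then on $\mathcal R^*(S_{1,1},\partial S_{1,1},\mathrm{SL}_2(\mathbb C))_{\rho_0}\setminus\{t_{12}=t_{1\bar2}\}$ the symplectic form is $$\omega=\pm2\,\frac{dt_1\wedge dt_2}{t_{12}-t_{1\bar2}} .$$
   Context: $t_1,t_2,t_{12},t_{1\bar2}$ are the trace functions $[\rho]\mapsto\operatorname{tr}\rho(\gamma)$ of $\gamma=\gamma_1,\gamma_2,\gamma_1\gamma_2,\gamma_1\gamma_2^{-1}$. A representation $\rho\colon\pi_1(S)\to\mathrm{SL}_2(\mathbb C)$ is good if its image is contained in no proper parabolic subgroup (i.e. it is irreducible) and its centralizer is the center. It is $\partial$-regular if each peripheral element is mapped to a regular element (in $\mathrm{SL}_2(\mathbb C)$: an element $\ne\pm\mathrm{Id}$). $\mathcal R^*(S,\partial S,\mathrm{SL}_2(\mathbb C))_{\rho_0}$ is the set of conjugacy classes $[\rho]$ of good representations such that, for every boundary component $\partial_i$, $\rho(\partial_i)$ is conjugate to $\rho_0(\partial_i)$. It is a complex manifold with tangent space at $[\rho]$ equal to $\ker\big(H^1(S;\operatorname{Ad}\rho)\to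 H^1(\partial S;\operatorname{Ad}\rho)\big)$ (a path $\rho_s$ corresponds to the class of $\gamma\mapsto\frac{d}{ds}\rho_s(\gamma)\rho(\gamma)^{-1}|_{s=0}$). The (Atiyah–Bott–Goldman) symplectic form: with $\mathcal B(X,Y)=-\operatorname{tr}(XY)$ on $\mathfrak{sl}_2(\mathbb C)$, for $a,b$ in this kernel, $\omega(a,b)=\langle\widetilde a,b\rangle$, where $\widetilde a\in H^1(S,\partial S;\operatorname{Ad}\rho)$ maps to $a$ and $\langle\cdot,\cdot\rangle\colon H^1(S,\partial S;\operatorname{Ad}\rho)\times H^1(S;\operatorname{Ad}\rho)\to\mathbb C$ is the Poincaré duality pairing (cup product, $\mathcal B$ on coefficients, evaluation on the fundamental class). *)

(* Defs.v *)
From HB Require Import structures.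
From mathcomp Require Import all_boot all_order all_algebra.
From mathcomp Require Import complex.
From mathcomp.multinomials Require Import freeg.
From mathcomp Require Import all_classical all_reals all_analysis.

Set Implicit Arguments.
Unset Strict Implicit.
Unset Printing Implicit Defensive.

Import Order.TTheory GRing.Theory Num.Theory.
Import numFieldNormedType.Exports.

Local Open Scope ring_scope.
Local Open Scope classical_set_scope.

(* The one-holed torus enters through the pair (pi_1(S), <c>), with pi_1(S)
   free on g1, g2 and c the peripheral element. Both the surface and its
   boundary circle are aspherical, so the (co)homology of S, of its boundary
   and of the pair is computed below by inhomogeneous bar (co)chains of pi_1(S)
   and of the subgroup <c>. *)

Definition free_on (pi : groupType) (g1 g2 : pi) : Prop :=
  forall (H : groupType) (h1 h2 : H),
    (exists f : pi -> H,
       [/\ {morph f : x y / (x * y)%g}, f g1 = h1 & f g2 = h2]) /\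
    (forall f f' : pi -> H,
       {morph f : x y / (x * y)%g} -> {morph f' : x y / (x * y)%g} ->
       f g1 = f' g1 -> f g2 = f' g2 -> f =1 f').

Definition peripheral (pi : groupType) (g1 g2 : pi) : pi :=
  (g1 * g2 * g1^-1 * g2^-1)%g.

Definition in_cycle (pi : groupType) (c g : pi) : Prop :=
  exists n : nat, g = (c ^+ n)%g \/ g = (c ^- n)%g.

Section Homology.
Context (pi : groupType).

Definition bar_d2 : {freeg (pi * pi)} -> {freeg pi} :=
  fglift (fun x => << x.2 >> - << (x.1 * x.2)%g >> + << x.1 >>).

Definition bar_d3 : {freeg (pi * pi * pi)} -> {freeg (pi * pi)} :=
  fglift (fun x => let: (g, h, k) := x in
    << (h, k) >> - << ((g * h)%g, k) >> + << (g, (h * k)%g) >> - << (g, h) >>).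

(* Relative cycles and boundaries are those of the quotient complex
   C_*(pi) / C_*(<c>). *)
Definition rel_cycle2 (c : pi) (z : {freeg (pi * pi)}) : Prop :=
  forall g, g \in dom (bar_d2 z) -> in_cycle c g.

Definition rel_homologous2 (c : pi) (z z' : {freeg (pi * pi)}) : Prop :=
  exists (y : {freeg (pi * pi * pi)}) (s : {freeg (pi * pi)}),
    (forall x, x \in dom s -> in_cycle c x.1 /\ in_cycle c x.2) /\
    z - z' = bar_d3 y + s.

(* H_2(S, boundary; Z) is infinite cyclic; the choice of one of its two
   generators is the choice of an orientation of S. *)
Definition fundamental_cycle (c : pi) (z : {freeg (pi * pi)}) : Prop :=
  rel_cycle2 c z /\
  forall z', rel_cycle2 c z' -> exists n : int, rel_homologous2 c z' (z *~ n).

End Homology.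

Section Representations.
Context (C : numClosedFieldType) (pi : groupType).

Definition representation (rho : pi -> 'M[C]_2) : Prop :=
  (forall g, \det (rho g) = 1) /\
  {morph rho : g h / (g * h)%g >-> g *m h}.

(* The proper parabolic subgroups of SL_2(C) are the stabilizers of the lines
   of C^2. *)
Definition parabolic (v : 'cV[C]_2) (A : 'M[C]_2) : Prop :=
  \det A = 1 /\ exists l : C, A *m v = l *: v.

Definition good (rho : pi -> 'M[C]_2) : Prop :=
  (forall v : 'cV[C]_2, v != 0 -> ~ (forall g, parabolic v (rho g))) /\
  (forall A : 'M[C]_2, \det A = 1 ->
     (forall g, A *m rho g = rho g *m A) <->
     (forall B : 'M[C]_2, \det B = 1 -> A *m B = B *m A)).

Definition boundary_regular (c : pi) (rho : pi -> 'M[C]_2) : Prop :=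
  rho c <> 1%:M /\ rho c <> - 1%:M.

Definition conjugate_SL2 (A B : 'M[C]_2) : Prop :=
  exists Q : 'M[C]_2, \det Q = 1 /\ B = Q *m A *m invmx Q.

(* The points of the relative character variety are the conjugacy classes of
   these rho. *)
Definition relative_rep (c : pi) (rho0 rho : pi -> 'M[C]_2) : Prop :=
  [/\ representation rho, good rho & conjugate_SL2 (rho0 c) (rho c)].

Definition trace_fun (g : pi) (rho : pi -> 'M[C]_2) : C := \tr (rho g).

Definition Ad (A X : 'M[C]_2) : 'M[C]_2 := A *m X *m invmx A.

Definition cocycle (rho a : pi -> 'M[C]_2) : Prop :=
  (forall g, \tr (a g) = 0) /\
  (forall g h, a (g * h)%g = a g + Ad (rho g) (a h)).

Definition coboundary (rho : pi -> 'M[C]_2) (X : 'M[C]_2) : pi -> 'M[C]_2 :=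
  fun g => Ad (rho g) X - X.

Definition cohomologous (rho a b : pi -> 'M[C]_2) : Prop :=
  exists X : 'M[C]_2, \tr X = 0 /\ forall g, b g - a g = coboundary rho X g.

(* a represents a class in ker (H^1(S; Ad rho) -> H^1(boundary; Ad rho)). *)
Definition tangent_cocycle (c : pi) (rho a : pi -> 'M[C]_2) : Prop :=
  cocycle rho a /\
  exists X : 'M[C]_2, \tr X = 0 /\
    forall p, in_cycle c p -> a p = coboundary rho X p.

(* Relative cochains vanish on <c>. There is no nonzero relative 0-cochain, so
   a class in H^1(S, boundary; Ad rho) is the same as a relative cocycle. *)
Definition rel_cocycle (c : pi) (rho u : pi -> 'M[C]_2) : Prop :=
  cocycle rho u /\ forall p, in_cycle c p -> u p = 0.

Definition form_B (X Y : 'M[C]_2) : C := - \tr (X *m Y).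

Definition cup (rho u v : pi -> 'M[C]_2) (x : pi * pi) : C :=
  form_B (u x.1) (Ad (rho x.1) (v x.2)).

Definition duality_pairing (z : {freeg (pi * pi)})
    (rho u v : pi -> 'M[C]_2) : C :=
  \sum_(x <- dom z) cup rho u v x *~ coeff x z.

(* w is the value of the symplectic form on the classes of a and b: every lift
   of the class of a gives w, and there is a lift. *)
Definition symplectic_value (c : pi) (z : {freeg (pi * pi)})
    (rho a b : pi -> 'M[C]_2) (w : C) : Prop :=
  (exists u, rel_cocycle c rho u /\ cohomologous rho a u) /\
  (forall u, rel_cocycle c rho u -> cohomologous rho a u ->
     duality_pairing z rho u b = w).

Definition curve_with_tangent (rho a : pi -> 'M[C]_2)
    (r : C -> pi -> 'M[C]_2) : Prop :=
  [/\ \forall s \near (0 : C), representation (r s),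
      r 0 = rho &
      forall g, is_derive (0 : C) (1 : C)
                  (fun s : C => r s g *m invmx (rho g)) (a g)].

(* df is the differential at rho of a function f on Hom(pi, SL_2(C)), a
   function on the tangent space Z^1(pi; Ad rho). As the conjugation invariant
   functions on Hom(pi, SL_2(C)) are used as functions on the relative
   character variety, their differentials are used on the cocycles tangent to
   it. *)
Definition is_differential (f : (pi -> 'M[C]_2) -> C) (rho : pi -> 'M[C]_2)
    (df : (pi -> 'M[C]_2) -> C) : Prop :=
  forall a, cocycle rho a ->
  forall r, curve_with_tangent rho a r ->
    is_derive (0 : C) (1 : C) (fun s : C => f (r s) : C) (df a).

Definition wedge (T : Type) (al be : T -> C) (a b : T) : C :=
  al a * be b - al b * be a.

End Representations.

(* Main.v *)
Require Import Defs.
From HB Require Import structures.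
From mathcomp Require Import all_boot all_order all_algebra.
From mathcomp Require Import complex.
From mathcomp.multinomials Require Import freeg.
From mathcomp Require Import all_classical all_reals all_analysis.
From mathcomp Require Import ring.

(* Write A, B for the images of g1, g2 and c for that of their commutator. The
   chain [g1|g2] - [g2|g1] - [c|g2 g1] has boundary -c, and the cup product of
   the two coordinate characters of the free group takes the value 1 on it, so
   it is homologous to plus or minus any fundamental cycle. As a relative
   cocycle u vanishes on c, the symplectic form becomes, up to sign,
     tr (u(g1) A b(g2) A^-1) - tr (u(g2) B b(g1) B^-1).
   The twist deformations of B along the traceless part of A, and of A along
   the traceless part of B, fix c; each has dt_i equal to
   (t_12 - t_1bar2) / 2 for one index i and 0 for the other, and their pairing
   with b is -dt_1(b), resp. dt_2(b). Subtracting a combination of the two from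
   u leaves a cocycle with dt_1 = dt_2 = 0. Since tr c is a polynomial in t_1,
   t_2, t_12 with derivative t_12 - t_1bar2 in t_12, this cocycle has dt_12 = 0
   as well, hence is the coboundary of some X by irreducibility. It is zero on
   c, so X commutes with c and the coboundary pairs to zero with b. *)

Set Implicit Arguments.
Unset Strict Implicit.
Unset Printing Implicit Defensive.

Import Order.TTheory GRing.Theory Num.Theory.
Import numFieldNormedType.Exports.

Local Open Scope ring_scope.
Local Open Scope classical_set_scope.

(** * Free groups and cochains *)

(** The elements satisfying [P] form a subgroup [T]. The universal property maps the group to [T],
    fixing the generators; followed by the inclusion, this map is the identity by uniqueness, so
    every element lies in [T]. *)
Lemma free_on_ind (pi : groupType) (g1 g2 : pi) (P : pi -> Prop) :
    free_on g1 g2 -> P g1 -> P g2 ->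
    (forall x y, P x -> P y -> P (x * y)%g) -> (forall x, P x -> P (x^-1)%g) ->
  forall g, P g.
Proof.
move=> hfree P1 P2 PM PV g.
have clP : group_closed (fun x : pi => `[< P x >]).
  split; first by apply/asboolP; rewrite -(mulgV g1); apply: PM => //; apply: PV.
  by move=> x y /asboolP Px /asboolP Py; apply/asboolP; apply: PM => //; apply: PV.
pose T := {x : pi | `[< P x >]}.
pose H : groupType := HB.pack T (SubChoice_isSubGroup.Build pi _ T clP).
have b1 : `[< P g1 >] by exact/asboolP.
have b2 : `[< P g2 >] by exact/asboolP.
pose h1 : T := exist _ g1 b1; pose h2 : T := exist _ g2 b2.
have [[f [fM f1 f2]] _] := hfree H h1 h2.
have [_ uniq] := hfree pi g1 g2.
have <- : sval (f g) = g.
  by apply: (uniq (fun x => sval (f x)) id) => [x y|x y||] //=; rewrite ?fM ?f1 ?f2.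
exact/asboolP/(svalP (f g)).
Qed.

Section SpecialLinear.
Context (C : comUnitRingType) (n : nat).

(** Made into a [groupType] so that it can be a target of the universal property: representations
    are then built from their values on the generators. *)
Definition SLmx := {A : 'M[C]_n | \det A == 1}.

Lemma SLmx_unit (A : SLmx) : val A \in unitmx.
Proof. by rewrite unitmxE (eqP (valP A)) unitr1. Qed.

Fact SLmx_det1 : \det (1%:M : 'M[C]_n) == 1.
Proof. by rewrite det1. Qed.

Fact SLmx_detM (A B : SLmx) : \det (val A *m val B) == 1.
Proof. by rewrite det_mulmx (eqP (valP A)) (eqP (valP B)) mulr1. Qed.

Fact SLmx_detV (A : SLmx) : \det (invmx (val A)) == 1.
Proof. by rewrite det_inv (eqP (valP A)) invr1. Qed.

Definition SLmx_one : SLmx := exist (fun A : 'M[C]_n => \det A == 1) _ SLmx_det1.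
Definition SLmx_mul A B : SLmx :=
  exist (fun A : 'M[C]_n => \det A == 1) _ (SLmx_detM A B).
Definition SLmx_inv A : SLmx := exist (fun A : 'M[C]_n => \det A == 1) _ (SLmx_detV A).

Fact SLmx_mulA : associative SLmx_mul.
Proof. by move=> A B D; apply/val_inj; rewrite /= mulmxA. Qed.
Fact SLmx_mul1 : left_id SLmx_one SLmx_mul.
Proof. by move=> A; apply/val_inj; rewrite /= mul1mx. Qed.
Fact SLmx_mulr1 : right_id SLmx_one SLmx_mul.
Proof. by move=> A; apply/val_inj; rewrite /= mulmx1. Qed.
Fact SLmx_mulV : left_inverse SLmx_one SLmx_inv SLmx_mul.
Proof. by move=> A; apply/val_inj; rewrite /= mulVmx ?SLmx_unit. Qed.
Fact SLmx_mulrV : right_inverse SLmx_one SLmx_inv SLmx_mul.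
Proof. by move=> A; apply/val_inj; rewrite /= mulmxV ?SLmx_unit. Qed.

HB.instance Definition _ := Choice.on SLmx.
HB.instance Definition _ := isGroup.Build SLmx
  SLmx_mulA SLmx_mul1 SLmx_mulr1 SLmx_mulV SLmx_mulrV.

End SpecialLinear.

Lemma free_on_int (pi : groupType) (g1 g2 : pi) (m1 m2 : int) :
  free_on g1 g2 ->
  exists f : pi -> int, [/\ {morph f : x y / (x * y)%g >-> x + y}, f g1 = m1 & f g2 = m2].
Proof.
move=> hfree.
pose Z : groupType := HB.pack int
  (isGroup.Build int (@addrA int) (@add0r int) (@addr0 int) (@addNr int) (@addrN int)).
by have [] := hfree Z m1 m2.
Qed.

(** * Evaluation of cochains on integral chains *)

Section FreeAbelian.

HB.instance Definition _ (K : choiceType) (M : lmodType int) (f : K -> M) :=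
  GRing.isZmodMorphism.Build {freeg K} M (fglift f) (lift_is_additive f).

Lemma fglift_sum (K : choiceType) (M : lmodType int) (f : K -> M) (z : {freeg K}) :
  fglift f z = \sum_(x <- dom z) f x *~ coeff x z.
Proof.
rewrite -[z in LHS]freeg_sumE raddf_sum.
by apply: eq_bigr => x _; rewrite /= liftU -scaler_int intz.
Qed.

(** [duality_pairing] unfolds to this with a cup product for [f]; general coefficients also allow
    integer cochains. *)
Definition eval_cochain (K : choiceType) (M : zmodType) (f : K -> M)
    (z : {freeg K}) : M :=
  \sum_(x <- dom z) f x *~ coeff x z.

Context (K : choiceType) (M : zmodType) (f : K -> M).

Lemma eval_cochainE : eval_cochain f = fglift (f : K -> zmodule M).
Proof. by apply/funext => w; rewrite fglift_sum. Qed.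

Fact eval_cochain_is_additive : zmod_morphism (eval_cochain f).
Proof.
move=> x y; rewrite eval_cochainE.
exact: (@lift_is_additive int K (zmodule M) f x y).
Qed.

HB.instance Definition _ :=
  GRing.isZmodMorphism.Build {freeg K} M (eval_cochain f) eval_cochain_is_additive.

Lemma eval_cochainU x : eval_cochain f << x >> = f x.
Proof. by rewrite eval_cochainE liftU scale1r. Qed.

Lemma eval_cochain_eq0 (z : {freeg K}) :
  (forall x, x \in dom z -> f x = 0) -> eval_cochain f z = 0.
Proof.
by move=> f0; rewrite /eval_cochain big_seq big1 // => x /f0 ->; rewrite mul0rz.
Qed.

Lemma eval_cochain_lift (J : choiceType) (h : J -> {freeg K}) (y : {freeg J}) :
  (forall x, eval_cochain f (h x) = 0) -> eval_cochain f (fglift h y) = 0.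
Proof.
move=> fh0; rewrite fglift_sum raddf_sum big1 // => x _.
by rewrite raddfMz /= fh0 mul0rz.
Qed.

End FreeAbelian.

(** * Two by two matrices *)

Lemma ord2_cases (k : 'I_2) : k = 0 \/ k = 1.
Proof. by case: k => -[|[|//]] h; [left|right]; apply/val_inj. Qed.

Lemma lift0_ord2 : fintype.lift ord0 ord0 = 1 :> 'I_2.
Proof. exact/val_inj. Qed.

Section Matrix2.
Context (F : fieldType).
Implicit Types A B P Q X c : 'M[F]_2.

Lemma mulmx2E A B i j : (A *m B) i j = A i 0 * B 0 j + A i 1 * B 1 j.
Proof. by rewrite mxE !big_ord_recl big_ord0 addr0 lift0_ord2. Qed.

Lemma mxtrace2E A : \tr A = A 0 0 + A 1 1.
Proof. by rewrite /mxtrace !big_ord_recl big_ord0 addr0 lift0_ord2. Qed.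

Lemma mx2P A B :
    A 0 0 = B 0 0 -> A 0 1 = B 0 1 -> A 1 0 = B 1 0 -> A 1 1 = B 1 1 ->
  A = B.
Proof.
move=> h00 h01 h10 h11; apply/matrixP => i j.
by have [-> | ->] := ord2_cases i; have [-> | ->] := ord2_cases j.
Qed.

Definition mx2E := (mxtrace2E, mulmx2E, mxE).

(** The adjugate, written so as to be visibly linear in [A]: inverses in SL_2 can then be
    differentiated linearly. *)
Definition adj2 A : 'M[F]_2 := (\tr A)%:M - A.

Lemma det2E A : \det A = A 0 0 * A 1 1 - A 0 1 * A 1 0.
Proof.
rewrite (expand_det_row _ 0) !big_ord_recl big_ord0 addr0 lift0_ord2.
rewrite /cofactor !det_mx11 !mxE /= expr0 expr1 mul1r mulN1r mulrN.
by congr (_ * A _ _ - _ * A _ _); apply/val_inj.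
Qed.


Ltac mx2ring := apply: mx2P; rewrite ?(det2E, mx2E) /= ?(mulr0n, mulr1n); ring.

Lemma mul_adj2 A : A *m adj2 A = (\det A)%:M.
Proof. by rewrite /adj2; mx2ring. Qed.

Lemma mul_adj2l A : adj2 A *m A = (\det A)%:M.
Proof. by rewrite /adj2; mx2ring. Qed.

Lemma invmx2 A : \det A = 1 -> invmx A = adj2 A.
Proof.
move=> dA; have uA : A \in unitmx by rewrite unitmxE dA unitr1.
by rewrite -[invmx A]mulmx1 -dA -mul_adj2 mulmxA mulVmx // mul1mx.
Qed.

Definition comm2 A B : 'M[F]_2 := A *m B - B *m A.

(** For the trace form, [N], [comm2 B N], [- comm2 A N] are dual, up to the factor [\tr (N *m N)],
    to [N] and the traceless parts of [A] and [B]. *)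
Lemma sl2_expand A B P (N := comm2 A B) : \tr P = 0 ->
  \tr (N *m N) *: P =
  \tr (P *m N) *: N + \tr (P *m A) *: comm2 B N - \tr (P *m B) *: comm2 A N.
Proof.
rewrite mxtrace2E => /(canRL (addKr _)); rewrite addr0 /N /comm2 => P11.
by apply: mx2P; rewrite !mx2E !P11; ring.
Qed.

(** Expand [P] and [Q] by [sl2_expand] and use [N = comm2 A B]. Each equation determines [X] up to a
    multiple of [A], resp. [B]; the two solutions have the same coefficient on [N] by the last
    hypothesis. *)
Lemma simultaneous_comm2 A B P Q (N := comm2 A B) :
    \tr (N *m N) != 0 -> \tr P = 0 -> \tr Q = 0 -> \tr (P *m A) = 0 ->
    \tr (Q *m B) = 0 -> \tr (P *m B) + \tr (Q *m A) = 0 ->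
  exists X, P = comm2 A X /\ Q = comm2 B X.
Proof.
move=> N0 trP trQ trPA trQB trPBQA.
exists ((\tr (N *m N))^-1 *:
  (\tr (P *m N) *: B - \tr (Q *m N) *: A - \tr (P *m B) *: N)).
have commZ U V k : comm2 U (k *: V) = k *: comm2 U V.
  by rewrite /comm2 -scalemxAr -scalemxAl scalerBr.
have commL k l m U : comm2 U (k *: B - l *: A - m *: N) =
    k *: comm2 U B - l *: comm2 U A - m *: comm2 U N.
  by rewrite /comm2; mx2ring.
split; apply: (scalerI N0); rewrite commZ scalerA divff // scale1r commL sl2_expand //.
  by rewrite trPA scale0r addr0 /comm2 subrr scaler0 subr0.
rewrite -/N trQB scale0r subr0 -(addrK (\tr (P *m B)) (\tr (Q *m A))) addrC.
by rewrite [_ + \tr (P *m B)]addrC trPBQA sub0r /comm2 /N; mx2ring.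
Qed.

Lemma mxtraceN A : \tr (- A) = - \tr A.
Proof. exact: raddfN. Qed.

Lemma mxtraceB A B : \tr (A - B) = \tr A - \tr B.
Proof. exact: raddfB. Qed.

Lemma mxtrace_comm2_sqr A B : \tr (comm2 A B *m comm2 A B) = - 2 * \det (comm2 A B).
Proof. by rewrite det2E /comm2 !mx2E; ring. Qed.

Lemma adj2M A B : adj2 (A *m B) = adj2 B *m adj2 A.
Proof. by rewrite /adj2; mx2ring. Qed.

(** The left side is the derivative of tr(A^2 B^2) along [(P, Q)]; the right side results from
    Cayley-Hamilton for [A] and [B] and its derivative. *)
Lemma trace_square_variation A B P Q :
  \tr (B *m B *m (A *m P + P *m A)) + \tr (A *m A *m (Q *m B + B *m Q)) =
  \tr A * \tr B * (\tr (P *m B) + \tr (Q *m A))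
  - \tr A * \det B * \tr P + \tr P * \tr (B *m B *m A)
  + (\tr (P *m A) - \tr A * \tr P) * \tr (B *m B)
  - \tr B * \det A * \tr Q + \tr Q * \tr (A *m A *m B)
  + (\tr (Q *m B) - \tr B * \tr Q) * \tr (A *m A).
Proof. by rewrite !det2E !mx2E; ring. Qed.

(* [\tr c] is a polynomial in [\tr A], [\tr B] and [\tr (A *m B)] whose
   derivative in the last variable is [2 * \tr (A *m B) - \tr A * \tr B]; this
   is the derivative of [\tr c] being zero along [(P, Q)]. *)
Lemma trace_commutator_variation A B P Q c :
    \det A = 1 -> \det B = 1 -> \tr P = 0 -> \tr Q = 0 ->
    \tr (P *m A) = 0 -> \tr (Q *m B) = 0 -> c *m (B *m A) = A *m B ->
    P *m B + A *m Q = c *m (Q *m A + B *m P) ->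
  (2 * \tr (A *m B) - \tr A * \tr B) * (\tr (P *m B) + \tr (Q *m A)) = 0.
Proof.
(* [S] and [T] are the derivatives of [A *m B] and [B *m A] along [(P, Q)]. *)
move=> dA dB tP tQ tPA tQB cBA; set S := _ + A *m Q; set T := _ + B *m P => ST.
set M := A *m B; set M' := B *m A in cBA.
have dM' : \det M' = 1 by rewrite det_mulmx dA dB mulr1.
have cE : c = M *m adj2 M'.
  by rewrite -[c]mulmx1 -dM' -mul_adj2 mulmxA cBA.
(* This is the derivative of [\det M'], zero because [\det A] and [\det B] are constant to first
   order. *)
have tT : \tr (T *m adj2 M') = 0.
  rewrite adj2M /T mulmxDl -!mulmxA [A *m _]mulmxA mul_adj2 dA mul1mx mxtraceD.
  rewrite [X in _ + X]mxtrace_mulC -!mulmxA mul_adj2l dB mulmx1.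
  rewrite /adj2 !mulmxBr !mul_mx_scalar !(mxtraceB, mxtraceZ) tP tQ tPA tQB.
  by rewrite !mulr0 subr0 addr0.
(* The inverse of [M'] differentiated in two ways: as an inverse, and as the linear expression
   [adj2 M']. *)
have TM : adj2 M' *m T *m adj2 M' = - adj2 T.
  have: T *m adj2 M' = - (M' *m adj2 T).
    have: T *m adj2 M' + M' *m adj2 T = (\tr (T *m adj2 M'))%:M.
      by rewrite /adj2; mx2ring.
    by rewrite tT raddf0 => /eqP; rewrite addr_eq0 => /eqP.
  by rewrite -mulmxA => ->; rewrite mulmxN mulmxA mul_adj2l dM' mul1mx.
have dtrc : \tr (S *m adj2 M') + \tr (M *m adj2 T) = 0.
  by rewrite ST cE -!mulmxA [adj2 M' *m (T *m _)]mulmxA TM !mulmxN mxtraceN addNr.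
have trS : \tr S = \tr (P *m B) + \tr (Q *m A).
  by rewrite mxtraceD [\tr (A *m Q)]mxtrace_mulC.
have trT : \tr T = \tr (P *m B) + \tr (Q *m A).
  by rewrite mxtraceD [\tr (B *m P)]mxtrace_mulC addrC.
have trM' : \tr M' = \tr M by rewrite mxtrace_mulC.
move: dtrc; rewrite /adj2 !mulmxBr !mul_mx_scalar !(mxtraceB, mxtraceZ) trM' trS trT.
set tau := _ + \tr (Q *m A).
(* The derivative of tr(M M'), which is tr(A^2 B^2) by cyclicity. *)
have : \tr (S *m M') + \tr (M *m T) = \tr A * \tr B * tau.
  have -> : \tr (S *m M') + \tr (M *m T) =
    \tr (B *m B *m (A *m P + P *m A)) + \tr (A *m A *m (Q *m B + B *m Q)).
    by rewrite /S /T /M /M' !mx2E; ring.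
  rewrite trace_square_variation tP tQ tPA tQB dA dB -/tau.
  ring.
move=> /(canRL (addrK _)) ->; rewrite mulrBl => <-; ring.
Qed.

(* The first two hypotheses on [P] and [Q] say that [P *m invmx A] and
   [Q *m invmx B] are traceless, the third one that the commutator [c] of [A]
   and [B] is constant to first order along [(P, Q)]. *)
Lemma goldman_form_trace (A B P Q b1 b2 Y c : 'M[F]_2)
    (D := \tr (A *m B) - \tr (A *m invmx B)) :
    \det A = 1 -> \det B = 1 -> \det (comm2 A B) != 0 -> 2 != 0 :> F -> D != 0 ->
    c \in unitmx -> c *m (B *m A) = A *m B ->
    \tr (P *m invmx A) = 0 -> \tr (Q *m invmx B) = 0 ->
    P *m B + A *m Q = c *m (Q *m A + B *m P) ->
    \tr b1 = 0 -> \tr b2 = 0 ->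
    b1 + A *m b2 *m invmx A =
      c *m Y *m invmx c - Y + c *m (b2 + B *m b1 *m invmx B) *m invmx c ->
  \tr (P *m b2 *m invmx A) - \tr (Q *m b1 *m invmx B) =
  2 / D * (\tr P * \tr (b2 *m B) - \tr (b1 *m A) * \tr Q).
Proof.
move=> dA dB dN two0 D0 uc cBA tPA tQB ST tb1 tb2 bY.
have uA : A \in unitmx by rewrite unitmxE dA unitr1.
have uB : B \in unitmx by rewrite unitmxE dB unitr1.
pose A0 := A - (\tr A / 2)%:M; pose B0 := B - (\tr B / 2)%:M.
have half x : x / 2 *+ 2 = x :> F by rewrite -mulr_natr mulfVK.
have tA0 : \tr A0 = 0 by rewrite mxtraceB mxtrace_scalar half subrr.
have tB0 : \tr B0 = 0 by rewrite mxtraceB mxtrace_scalar half subrr.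
have DE : D = 2 * \tr (A *m B) - \tr A * \tr B.
  rewrite /D invmx2 // /adj2 mulmxBr mul_mx_scalar mxtraceB mxtraceZ; ring.
have tAB0 : \tr (A *m B0) = D / 2.
  rewrite DE mulmxBr mul_mx_scalar mxtraceB mxtraceZ; field.
  exact: two0.
have tBA0 : \tr (B *m A0) = D / 2.
  rewrite DE mulmxBr mul_mx_scalar mxtraceB mxtraceZ mxtrace_mulC; field.
  exact: two0.
have BB0 : B *m B0 = B0 *m B by rewrite mulmxBr mulmxBl scalar_mxC.
have AA0 : A *m A0 = A0 *m A by rewrite mulmxBr mulmxBl scalar_mxC.
have b2B0 : \tr (b2 *m B0) = \tr (b2 *m B).
  by rewrite mulmxBr mul_mx_scalar mxtraceB mxtraceZ tb2 mulr0 subr0.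
have b1A0 : \tr (b1 *m A0) = \tr (b1 *m A).
  by rewrite mulmxBr mul_mx_scalar mxtraceB mxtraceZ tb1 mulr0 subr0.
clearbody A0 B0.
(* The twists A exp(s B0) and B exp(s A0) have trace derivative [D / 2], so these multiples of them
   make [P0] and [Q0] traceless. *)
pose p := 2 / D * \tr P; pose q := 2 / D * \tr Q.
pose P0 := P - p *: (A *m B0); pose Q0 := Q - q *: (B *m A0).
have tP0 : \tr P0 = 0.
  by rewrite mxtraceB mxtraceZ tAB0 /p; field; rewrite D0 two0.
have tQ0 : \tr Q0 = 0.
  by rewrite mxtraceB mxtraceZ tBA0 /q; field; rewrite D0 two0.
have tr_adj (U V : 'M[F]_2) : \det V = 1 -> \tr U = 0 ->
    \tr (U *m invmx V) = 0 -> \tr (U *m V) = 0.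
  move=> dV tU; rewrite invmx2 // /adj2 mulmxBr mul_mx_scalar mxtraceB mxtraceZ.
  rewrite tU mulr0 sub0r.
  by move/eqP; rewrite oppr_eq0 => /eqP.
have tP0A : \tr (P0 *m A) = 0.
  apply: tr_adj => //; rewrite mulmxBl mxtraceB tPA -scalemxAl mxtraceZ.
  by rewrite mxtrace_mulC mulmxA mulVmx // mul1mx tB0 mulr0 subrr.
have tQ0B : \tr (Q0 *m B) = 0.
  apply: tr_adj => //; rewrite mulmxBl mxtraceB tQB -scalemxAl mxtraceZ.
  by rewrite mxtrace_mulC mulmxA mulVmx // mul1mx tA0 mulr0 subrr.
(* Both twists preserve [c], since [B0] commutes with [B] and [A0] with [A]. *)
have ST0 : P0 *m B + A *m Q0 = c *m (Q0 *m A + B *m P0).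
  have e1 : A *m (B *m A0) = c *m (B *m A0 *m A).
    by rewrite -[B *m A0 *m A]mulmxA -AA0 !mulmxA -[c *m B *m A]mulmxA cBA.
  have e2 : A *m B0 *m B = c *m (B *m (A *m B0)).
    by rewrite -mulmxA -BB0 !mulmxA -[c *m B *m A]mulmxA cBA.
  rewrite /P0 /Q0 !mulmxBl !mulmxBr addrACA ST -!scalemxAl -!scalemxAr e1 e2.
  rewrite mulmxDr [in RHS]mulmxDr !mulmxBr -!scalemxAr [RHS]addrACA.
  by rewrite [X in _ = _ + X]addrC.
have tau0 : \tr (P0 *m B) + \tr (Q0 *m A) = 0.
  have := trace_commutator_variation dA dB tP0 tQ0 tP0A tQ0B cBA ST0.
  by rewrite -DE => /eqP; rewrite mulf_eq0 (negPf D0) => /eqP.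
have [|X [P0E Q0E]] := simultaneous_comm2 _ tP0 tQ0 tP0A tQ0B tau0.
  by rewrite mxtrace_comm2_sqr mulf_neq0 // oppr_eq0.
have commM U V : comm2 U X *m V + U *m comm2 V X = comm2 (U *m V) X.
  by rewrite /comm2 mulmxBl mulmxBr !mulmxA addrC addrA subrK.
(* With [P0] and [Q0] commutators with [X], [ST0] reads [AB, X] = c [BA, X]; cancel using AB =
   cBA. *)
have cX : X *m c = c *m X.
  have uBA : B *m A \in unitmx by rewrite unitmx_mul uA uB.
  apply: (can_inj (mulmxK uBA)); rewrite -mulmxA cBA.
  move: ST0; rewrite P0E Q0E !commM /comm2 mulmxBr !mulmxA -[c *m B *m A]mulmxA cBA.
  by move/addrI/oppr_inj => ->.
have conjX Z : \tr (X *m (c *m Z *m invmx c)) = \tr (X *m Z).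
  by rewrite !mulmxA cX mxtrace_mulC !mulmxA mulVmx // mul1mx.
(* Pair the boundary relation [bY] with [X]: conjugation by [c] is invisible to [X], so the terms in
   [Y] cancel. *)
have trw : \tr (X *m (b1 + A *m b2 *m invmx A)) = \tr (X *m (b2 + B *m b1 *m invmx B)).
  by rewrite bY mulmxDr mulmxBr mxtraceD mxtraceB !conjX subrr add0r.
have comm_conj U b : U \in unitmx ->
    \tr (comm2 U X *m b *m invmx U) = \tr (X *m b) - \tr (X *m (U *m b *m invmx U)).
  move=> uU; rewrite /comm2 !mulmxBl mxtraceB !mulmxA; congr (_ - _).
  by rewrite mxtrace_mulC !mulmxA mulVmx // mul1mx.
have twist U V b : U \in unitmx -> \tr (U *m V *m b *m invmx U) = \tr (b *m V).
  by move=> uU; rewrite mxtrace_mulC !mulmxA mulVmx // mul1mx mxtrace_mulC.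
have PE : P = P0 + p *: (A *m B0) by rewrite subrK.
have QE : Q = Q0 + q *: (B *m A0) by rewrite subrK.
clearbody P0 Q0; rewrite {1}PE {1}QE !mulmxDl !mxtraceD -!scalemxAl !mxtraceZ.
rewrite !twist // b2B0 b1A0.
rewrite P0E Q0E !comm_conj //.
move: trw; rewrite !mulmxDr !mxtraceD => /(canRL (addrK _)) ->.
rewrite /p /q; ring.
Qed.

End Matrix2.

(** * The fundamental class *)

Section RelativeClass.
Context (pi : groupType) (g1 g2 : pi).
Local Notation c := (peripheral g1 g2).

(** The cocycle identity kills the boundary [bar_d3 y], and vanishing on the peripheral subgroup
    kills [s]. *)
Lemma eval_rel_homologous2 (M : zmodType) (f : pi * pi -> M) (p : pi)
    (z z' : {freeg (pi * pi)}) :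
    (forall g h k, f (h, k) - f ((g * h)%g, k) + f (g, (h * k)%g) - f (g, h) = 0) ->
    (forall x, in_cycle p x.1 -> in_cycle p x.2 -> f x = 0) ->
  rel_homologous2 p z z' -> eval_cochain f z = eval_cochain f z'.
Proof.
move=> fcocycle f0 [y [s [sp zz']]]; apply/eqP; rewrite -subr_eq0 -raddfB zz'.
rewrite raddfD /= (@eval_cochain_eq0 _ _ _ s) => [|x /sp[]]; last exact: f0.
rewrite addr0; apply/eqP/eval_cochain_lift => -[[g h] k].
by rewrite !(raddfB, raddfD) /= !eval_cochainU.
Qed.

Definition commutator_chain : {freeg (pi * pi)} :=
  << (g1, g2) >> - << (g2, g1) >> - << (c, (g2 * g1)%g) >>.

Lemma peripheralK : (c * (g2 * g1) = g1 * g2)%g.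
Proof. by rewrite /peripheral !mulgA mulgVK mulgVK. Qed.

Lemma rel_cycle2_commutator_chain : rel_cycle2 c commutator_chain.
Proof.
move=> g; have -> : bar_d2 commutator_chain = - << c >>.
  rewrite /bar_d2 /commutator_chain !raddfB /= !liftU !scale1r /= peripheralK.
  have boundary (a b m n d : {freeg pi}) :
      a - m + b - (b - n + a) - (n - m + d) = - d.
    have -> : a - m + b - (b - n + a) = n - m.
      rewrite [a - m + b]addrAC -[a + b - m]addrA [b - n + a]addrC opprD addrACA.
      by rewrite subrr add0r opprB addrC addrA subrK.
    by rewrite opprD addrA subrr sub0r.
  exact: boundary.
rewrite domN domU1 inE => /eqP ->.
by exists 1%N; left; rewrite expg1.
Qed.

Lemma eval_commutator_chain (M : zmodType) (f : pi * pi -> M) :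
  (forall x, in_cycle c x.1 -> f x = 0) ->
  eval_cochain f commutator_chain = f (g1, g2) - f (g2, g1).
Proof.
move=> f0; rewrite /commutator_chain !raddfB /= !eval_cochainU [f (c, _)]f0 ?subr0 //.
by exists 1%N; left; rewrite expg1.
Qed.

(** The integer cocycle [f] takes the value 1 on the commutator chain, hence [n] times an integer is
    1 and [n] is a unit. *)
Lemma fundamental_commutator_chain (z : {freeg (pi * pi)}) :
    free_on g1 g2 -> fundamental_cycle c z ->
  exists n : int, (n = 1 \/ n = -1) /\
    rel_homologous2 c commutator_chain (z *~ n).
Proof.
move=> hfree [_ /(_ _ rel_cycle2_commutator_chain)[n zn]]; exists n; split=> //.
have [al [alM al1 al2]] := free_on_int 1 0 hfree.
have [be [beM be1 be2]] := free_on_int 0 1 hfree.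
(* A character to an abelian group kills the commutator [c], so [f] below is a relative cocycle. *)
have morph_cycle (f : pi -> int) : {morph f : x y / (x * y)%g >-> x + y} ->
    forall g, in_cycle c g -> f g = 0.
  move=> fM.
  have f1 : f 1%g = 0 by apply: (addrI (f 1%g)); rewrite -fM mulg1 addr0.
  have fV x : f x^-1%g = - f x by apply: (addrI (f x)); rewrite -fM mulgV f1 subrr.
  have fc : f c = 0 by rewrite /peripheral !fM !fV; ring.
  have fX k : f (c ^+ k)%g = 0 by elim: k => [|k IH]; rewrite ?expg0 // expgS fM fc IH.
  by move=> g [k [->|->]]; rewrite ?fV fX ?oppr0.
pose f (x : pi * pi) : int := al x.1 * be x.2.
have f0 x : in_cycle c x.1 -> f x = 0.
  by move=> /(morph_cycle _ alM) a0; rewrite /f a0 mul0r.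
have : eval_cochain f commutator_chain = 1.
  by rewrite eval_commutator_chain // /f /= al1 al2 be1 be2.
rewrite (@eval_rel_homologous2 _ _ c _ _ _ _ zn); last first.
- by move=> x /f0.
- by move=> g h k; rewrite /f /= alM beM; ring.
rewrite raddfMz /= => /eqP; rewrite -mulrzr intz.
move: (eval_cochain f z) => e en1.
have /orP[] : (n == 1) || (n == -1) by apply: (@intUnitRing.unitzPl n e); exact/eqP.
  by move/eqP; left.
by move/eqP; right.
Qed.

End RelativeClass.

(** * Irreducible representations *)

Section Irreducible.
Context (C : numClosedFieldType) (pi : groupType).
Implicit Types rho : pi -> 'M[C]_2.

Lemma rep_unit rho g : representation rho -> rho g \in unitmx.
Proof. by move=> [dr _]; rewrite unitmxE dr unitr1. Qed.

Lemma rep1 rho : representation rho -> rho 1%g = 1%:M.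
Proof.
move=> hr; have [_ rM] := hr.
by apply: (can_inj (mulmxK (rep_unit 1%g hr))); rewrite -rM mul1mx mulg1.
Qed.

Lemma repV rho g : representation rho -> rho g^-1%g = invmx (rho g).
Proof.
move=> hr; have [_ rM] := hr.
apply: (can_inj (mulmxK (rep_unit g hr))); rewrite -rM mulVg rep1 //.
by rewrite mulVmx // rep_unit.
Qed.

(** With [comm2_mulr], this makes the kernel of the commutator invariant under [A] and [B]. *)
Lemma comm2_mull (A B : 'M[C]_2) :
  comm2 A B *m A = (\tr A)%:M *m comm2 A B - A *m comm2 A B.
Proof. by rewrite /comm2; apply: mx2P; rewrite !mx2E /= ?(mulr0n, mulr1n); ring. Qed.

Lemma comm2_mulr (A B : 'M[C]_2) :
  comm2 A B *m B = (\tr B)%:M *m comm2 A B - B *m comm2 A B.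
Proof. by rewrite /comm2; apply: mx2P; rewrite !mx2E /= ?(mulr0n, mulr1n); ring. Qed.

Lemma ker2_line (N : 'M[C]_2) (v w : 'cV_2) : N != 0 -> v != 0 ->
  N *m v = 0 -> N *m w = 0 -> exists l : C, w = l *: v.
Proof.
have colE (u : 'cV[C]_2) i : (N *m u) i 0 = N i 0 * u 0 0 + N i 1 * u 1 0.
  by rewrite mxE !big_ord_recl big_ord0 addr0 lift0_ord2.
move=> N0 v0 Nv Nw.
(* The determinant of [(v, w)] vanishes: eliminate between the two equations given by a row of [N]
   with a nonzero entry. *)
have E : v 0 0 * w 1 0 = v 1 0 * w 0 0.
  have [i [j Nij]] : exists i j, N i j != 0.
    apply: contrapT => h; case/negP: N0; apply/eqP/matrixP => i j; rewrite mxE.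
    by apply: contrapT => /eqP hij; apply: h; exists i, j.
  have /matrixP/(_ i 0) := Nv; rewrite colE mxE => e1.
  have /matrixP/(_ i 0) := Nw; rewrite colE mxE => e2.
  apply: (mulfI Nij); apply/eqP; rewrite -subr_eq0; apply/eqP.
  have [-> | ->] := ord2_cases j.
    transitivity (w 1 0 * (N i 0 * v 0 0 + N i 1 * v 1 0) -
      v 1 0 * (N i 0 * w 0 0 + N i 1 * w 1 0)); first by ring.
    by rewrite e1 e2 !mulr0 subrr.
  transitivity (v 0 0 * (N i 0 * w 0 0 + N i 1 * w 1 0) -
    w 0 0 * (N i 0 * v 0 0 + N i 1 * v 1 0)); first by ring.
  by rewrite e1 e2 !mulr0 subrr.
have colP (l : C) : w 0 0 = l * v 0 0 -> w 1 0 = l * v 1 0 -> w = l *: v.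
  move=> h0 h1; apply/matrixP => i j; rewrite ord1 mxE.
  by have [-> | ->] := ord2_cases i.
have [v00 | v00] := eqVneq (v 0 0) 0.
  have v10 : v 1 0 != 0.
    apply: contraNneq v0 => v10; apply/eqP/matrixP => i j; rewrite ord1 mxE.
    by have [-> | ->] := ord2_cases i.
  exists (w 1 0 / v 1 0); apply: colP; last by rewrite divfK.
  move: E; rewrite v00 mul0r mulr0 => /esym/eqP.
  by rewrite mulf_eq0 (negPf v10) => /eqP.
exists (w 0 0 / v 0 0); apply: colP; first by rewrite divfK.
by apply: (mulfI v00); rewrite E; field.
Qed.

Lemma central_scalar (A : 'M[C]_2) :
  (forall B : 'M[C]_2, \det B = 1 -> A *m B = B *m A) -> exists l, A = l%:M.
Proof.
move=> Acomm.
(* [U 1 0] and [U 0 1] are the upper and lower elementary unipotents; commuting with both already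
   forces a scalar. *)
pose U (x y : C) : 'M[C]_2 := \matrix_(i, j)
  (if i == j then 1 else if i == 0 then x else y).
have dU x y : x * y = 0 -> \det (U x y) = 1.
  by move=> xy; rewrite det2E !mxE /= xy subr0 mulr1.
have /matrixP AU := Acomm (U 1 0) (dU _ _ (mulr0 _)).
have /matrixP AV := Acomm (U 0 1) (dU _ _ (mul0r _)).
exists (A 0 0); apply: mx2P; rewrite mxE /=.
- by rewrite mulr1n.
- have := AV 0 0; rewrite !mulmx2E !mxE /= !mulr1 mul1r mul0r addr0.
  by move/(canRL (addKr _)); rewrite addNr mulr0n.
- have := AU 0 0; rewrite !mulmx2E !mxE /= !mulr1 !mul1r mulr0 addr0.
  by move/esym/(canRL (addKr _)); rewrite addNr mulr0n.
- have := AU 0 1; rewrite !mulmx2E !mxE /= !mulr1 !mul1r addrC.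
  by move/addrI; rewrite mulr1n.
Qed.

(** A singular commutator gives a common eigenvector, against irreducibility. If it is nonzero, its
    kernel is an invariant line; if it is zero, [A] and [B] centralize the image, hence are
    scalar. *)
Lemma good_comm2 (g1 g2 : pi) rho : free_on g1 g2 -> representation rho ->
  good rho -> \det (comm2 (rho g1) (rho g2)) != 0.
Proof.
move=> hfree hr [irr cent]; have [dr rM] := hr.
set A := rho g1; set B := rho g2; set N := comm2 A B.
have no_common (v : 'cV[C]_2) : v != 0 -> ~ ((exists l, A *m v = l *: v) /\
    (exists l, B *m v = l *: v)).
  move=> v0 [Av Bv]; apply: (irr v v0) => g; split; first exact: dr.
  apply: (free_on_ind hfree (P := fun g => exists l, rho g *m v = l *: v)) => //.
    move=> x y [k xv] [l yv]; exists (l * k).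
    by rewrite rM -mulmxA yv -scalemxAr xv scalerA.
  move=> x [l xv]; exists l^-1.
  have l0 : l != 0.
    apply: contraNneq v0 => l0; move: xv; rewrite l0 scale0r => xv.
    by rewrite -[v]mul1mx -(mulVmx (rep_unit x hr)) -mulmxA xv mulmx0.
  apply: (scalerI l0); rewrite scalerA divff // scale1r scalemxAr -xv.
  by rewrite repV // mulmxA mulVmx ?mul1mx // rep_unit.
apply/eqP => dN; have [N0 | N0] := eqVneq N 0.
  have scal (A0 : 'M[C]_2) : \det A0 = 1 -> A0 *m A = A *m A0 -> A0 *m B = B *m A0 ->
      exists l, A0 = l%:M.
    move=> dA0 A0A A0B; apply/central_scalar/(cent A0 dA0).1.
    apply: (free_on_ind hfree) => // [x y xA yA|x xA].
      by rewrite rM mulmxA xA -mulmxA yA mulmxA.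
    rewrite repV //; apply: (can_inj (mulmxK (rep_unit x hr))).
    rewrite -mulmxA mulVmx ?rep_unit // mulmx1 -mulmxA xA mulmxA.
    by rewrite mulVmx ?rep_unit // mul1mx.
  have AB : A *m B = B *m A by apply/eqP; rewrite -subr_eq0; apply/eqP.
  have [k Ak] := scal A (dr _) erefl AB.
  have [l Bl] := scal B (dr _) (esym AB) erefl.
  apply: (no_common (const_mx 1)).
    by apply/eqP => /matrixP/(_ 0 0)/eqP; rewrite !mxE oner_eq0.
  by split; [exists k; rewrite Ak mul_scalar_mx|exists l; rewrite Bl mul_scalar_mx].
(* [det0P] yields a row vector, whence the transposes. *)
have /det0P[v v0 vN] : \det N^T == 0 by rewrite det_tr dN.
have v0' : v^T != 0 by rewrite trmx_eq0.
have Nv : N *m v^T = 0 by rewrite -[N]trmxK -trmx_mul vN trmx0.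
apply: (no_common _ v0'); split; apply: (ker2_line N0 v0' Nv); rewrite mulmxA.
  by rewrite comm2_mull mulmxBl -!mulmxA Nv !mulmx0 subrr.
by rewrite comm2_mulr mulmxBl -!mulmxA Nv !mulmx0 subrr.
Qed.

End Irreducible.

(** * Curves of representations *)

Section MatrixDerivative.
Context (K : numFieldType) (V : normedModType K) (m n : nat).

(** Balls of matrices are entrywise, and finitely many entries can be controlled at once. *)
Lemma is_derive_mx (f : V -> 'M[K]_(m.+1, n.+1)) (df : 'M[K]_(m.+1, n.+1)) (x v : V) :
    (forall i j, is_derive x v (fun s => f s i j : K) (df i j)) ->
  is_derive x v f df.
Proof.
move=> dfij.
have cvf : h^-1 *: ((f \o shift x) (h *: v) - f x) @[h --> 0^'] --> df.
  apply/cvg_ballP => e e0.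
  have cvij i j : \forall h \near 0^',
      ball (df i j) e (h^-1 *: ((f \o shift x) (h *: v) - f x) i j).
    have [dij <-] := dfij i j.
    have /cvg_ballP/(_ e e0) := dij.
    by apply: filterS => h; rewrite !mxE.
  have : \forall h \near 0^', forall i j,
      ball (df i j) e (h^-1 *: ((f \o shift x) (h *: v) - f x) i j).
    by apply: filter_forall => i; apply: filter_forall => j; exact: cvij.
  apply: filterS => h hij; rewrite /ball /=; split=> [|i j]; first exact: e0.
  by have := hij i j; rewrite !mxE.
by apply: DeriveDef; [apply/cvg_ex; exists df|apply: cvg_lim].
Qed.

End MatrixDerivative.

(** Keeps the denominator in [sl2_path] nonzero: for nonzero [k], its only zero has modulus
    1/|k|. *)
Lemma near0_addM_neq0 (C: numFieldType) (k : C) : \forall s \near (0 : C), 1 + s * k != 0.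
Proof.
have [-> | k0] := eqVneq k 0.
  near=> s; by rewrite mulr0 addr0 oner_neq0.
have k0' : 0 < `|k|^-1 by rewrite invr_gt0 normr_gt0.
near=> s; have : `|s| < `|k|^-1 by near: s; exact: (@nbhs0_lt C C _ k0').
apply: contraTneq => /eqP.
rewrite addrC addr_eq0 => /eqP sk.
have : `|s * k| = 1 by rewrite sk normrN1.
rewrite normrM => /(canRL (mulfK _)); rewrite mul1r => -> //; last by rewrite normr_eq0.
by rewrite ltxx.
Unshelve. all: by end_near. Qed.

Section EntrywiseDerivative.
Context (C : numFieldType).
Implicit Types (f g : C -> 'M[C]_2).

Definition entrywise_derive (f : C -> 'M[C]_2) (df : 'M[C]_2) : Prop :=
  forall i j, is_derive (0 : C) (1 : C) (fun s => f s i j : C) (df i j).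

Lemma entrywise_derive_cst A : entrywise_derive (fun=> A) 0.
Proof. by move=> i j; rewrite mxE; exact: is_derive_cst. Qed.

Lemma entrywise_derive_mulmx f g df dg :
    entrywise_derive f df -> entrywise_derive g dg ->
  entrywise_derive (fun s => f s *m g s) (df *m g 0 + f 0 *m dg).
Proof.
move=> hf hg i j.
rewrite (_ : (fun s => _) = (fun s => f s i 0 : C) * (fun s => g s 0 j : C) +
  (fun s => f s i 1 : C) * (fun s => g s 1 j : C)); last first.
  by apply/funext => s; rewrite mulmx2E.
have ? := hf i 0; have ? := hf i 1; have ? := hg 0 j; have ? := hg 1 j.
apply: is_derive_eq; rewrite !mx2E /= /GRing.scale /=; ring.
Qed.

Lemma entrywise_derive_adj2 f df : entrywise_derive f df ->
  entrywise_derive (fun s => adj2 (f s)) (adj2 df).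
Proof.
move=> hf i j.
rewrite (_ : (fun s => _) = (i == j)%:R *:
  ((fun s => f s 0 0 : C) + (fun s => f s 1 1 : C)) -
  (fun s => f s i j : C)); last first.
  apply/funext => s; rewrite /adj2 !mx2E.
  by rewrite [LHS](_ : _ = (i == j)%:R * (f s 0 0 + f s 1 1) - f s i j) // mulr_natl.
have ? := hf 0 0; have ? := hf 1 1; have ? := hf i j.
by apply: is_derive_eq; rewrite /adj2 !mx2E /GRing.scale /= mulr_natl.
Qed.

Lemma is_derive_mxtrace f df : entrywise_derive f df ->
  is_derive (0 : C) (1 : C) (fun s => \tr (f s) : C) (\tr df).
Proof.
move=> hf.
rewrite (_ : (fun s => _) = (fun s => f s 0 0 : C) + (fun s => f s 1 1 : C)); last first.
  by apply/funext => s; rewrite mxtrace2E.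
have ? := hf 0 0; have ? := hf 1 1.
by apply: is_derive_eq; rewrite mxtrace2E.
Qed.

(* The lower right entry is the one making the determinant 1. *)
Definition sl2_path (X : 'M[C]_2) (s : C) : 'M[C]_2 :=
  1%:M + \matrix_(i, j) if (i == 1) && (j == 1)
    then (s * X 0 1 * (s * X 1 0) - s * X 0 0) / (1 + s * X 0 0) else s * X i j.

Lemma sl2_path0 (X : 'M[C]_2) : sl2_path X 0 = 1%:M.
Proof.
rewrite /sl2_path -[RHS]addr0; congr (_ + _); apply/matrixP => i j.
by rewrite !mxE !mul0r subr0 mul0r if_same.
Qed.

Lemma det_sl2_path (X : 'M[C]_2) s : 1 + s * X 0 0 != 0 -> \det (sl2_path X s) = 1.
Proof. by move=> h; rewrite det2E !mxE /= ?(mulr0n, mulr1n); field. Qed.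

(** The lower right entry has derivative [- X 0 0], which is [X 1 1] because the trace vanishes. *)
Lemma entrywise_derive_sl2_path (X : 'M[C]_2) :
  \tr X = 0 -> entrywise_derive (sl2_path X) X.
Proof.
rewrite mxtrace2E => /(canRL (addKr _)); rewrite addr0 => X11.
have dlin (k : C) : is_derive (0 : C) (1 : C) (fun s : C => s * k : C) k.
  rewrite (_ : (fun s => _) = k *: (id : C -> C)); last first.
    by apply/funext => s; rewrite mulrC.
  by apply: is_derive_eq; rewrite /GRing.scale /= mulr1.
move=> i j; have [/andP[/eqP -> /eqP ->] | /negPf nij] := boolP ((i == 1) && (j == 1)).
  rewrite (_ : (fun s => _) = 1 +
    ((fun s : C => s * X 0 1 : C) * (fun s : C => s * X 1 0 : C) -
    (fun s : C => s * X 0 0 : C)) * (fun s => (1 + s * X 0 0)^-1 : C)); last first.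
    by apply/funext => s; rewrite !mxE /= mulr1n.
  have h1 : is_derive (0 : C) (1 : C) (fun s : C => 1 + s * X 0 0 : C) (X 0 0).
    have := is_deriveD (is_derive_cst (1 : C) (0 : C) (1 : C)) (dlin (X 0 0)).
    by rewrite add0r.
  have h2 : is_derive (0 : C) (1 : C) (fun s : C => (1 + s * X 0 0)^-1 : C) (- X 0 0).
    have n0 : 1 + 0 * X 0 0 != 0 :> C by rewrite mul0r addr0 oner_neq0.
    have [d1 e1] := h1.
    apply: DeriveDef; first exact: (@derivableV _ _ (fun s : C => 1 + s * X 0 0)).
    rewrite (@deriveV _ _ (fun s : C => 1 + s * X 0 0)) // e1 mul0r addr0 expr1n invr1.
    by rewrite /GRing.scale /= mulN1r.
  have ? := dlin (X 0 1); have ? := dlin (X 1 0); have ? := dlin (X 0 0).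
  apply: is_derive_eq; rewrite X11 /GRing.scale /= !fctE.
  rewrite !mul0r !addr0 invr1; ring.
rewrite (_ : (fun s => _) =
  cst ((i == j)%:R : C) + (fun s : C => s * X i j : C)); last first.
  by apply/funext => s; rewrite !mxE nij.
have ? := dlin (X i j).
by apply: is_derive_eq; rewrite add0r.
Qed.

End EntrywiseDerivative.

Lemma invmxM (R : comUnitRingType) n (A B : 'M[R]_n) :
  A \in unitmx -> B \in unitmx -> invmx (A *m B) = invmx B *m invmx A.
Proof.
move=> uA uB; have uAB : A *m B \in unitmx by rewrite unitmx_mul uA.
apply: (can_inj (mulKmx uAB)); rewrite mulmxV // !mulmxA -[A *m B *m _]mulmxA.
by rewrite mulmxV // mulmx1 mulmxV.
Qed.

(** * Cocycles and curves tangent to them *)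

Section Cocycles.
Context (C : numClosedFieldType) (pi : groupType).
Implicit Types (rho a u : pi -> 'M[C]_2) (g : pi).

Lemma AdD (A X Y : 'M[C]_2) : Ad A (X + Y) = Ad A X + Ad A Y.
Proof. by rewrite /Ad mulmxDr mulmxDl. Qed.

Lemma AdN (A X : 'M[C]_2) : Ad A (- X) = - Ad A X.
Proof. by rewrite /Ad mulmxN mulNmx. Qed.

Lemma Ad_mul (A B X : 'M[C]_2) : A \in unitmx -> B \in unitmx ->
  Ad (A *m B) X = Ad A (Ad B X).
Proof. by move=> uA uB; rewrite /Ad invmxM // !mulmxA. Qed.

Lemma mxtrace_Ad (A X : 'M[C]_2) : A \in unitmx -> \tr (Ad A X) = \tr X.
Proof. by move=> uA; rewrite /Ad mxtrace_mulC mulmxA mulVmx // mul1mx. Qed.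

Lemma cocycle1 rho a : representation rho -> cocycle rho a -> a 1%g = 0.
Proof.
move=> hr [_ aM]; apply: (addIr (a 1%g)); rewrite add0r -[in RHS](mulg1 1%g) aM.
by rewrite (rep1 hr) /Ad mul1mx invmx1 mulmx1.
Qed.

Lemma cocycleV rho a g : representation rho -> cocycle rho a ->
  a g^-1%g = - Ad (invmx (rho g)) (a g).
Proof.
move=> hr ha; have [_ aM] := ha; apply/eqP; rewrite -addr_eq0 -repV // -aM.
by rewrite mulVg (cocycle1 hr).
Qed.

Lemma mxtrace_coboundary_mul rho X g : representation rho ->
  \tr (coboundary rho X g *m rho g) = 0.
Proof.
move=> hr; rewrite /coboundary /Ad mulmxBl mxtraceB mulmxKV ?rep_unit //.
by rewrite mxtrace_mulC subrr.
Qed.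

Lemma cocycle_sub_coboundary rho a X : representation rho -> \tr X = 0 ->
  cocycle rho a -> cocycle rho (fun g => a g - coboundary rho X g).
Proof.
move=> hr tX [ta aM]; split=> [g|g h].
  by rewrite mxtraceB /coboundary mxtraceB mxtrace_Ad ?rep_unit // ta tX !subrr.
rewrite aM /coboundary hr.2 Ad_mul ?rep_unit // !(AdD, AdN).
by rewrite !opprB [RHS]addrACA; congr (_ + _); rewrite addrA subrK.
Qed.

(* Along a curve tangent to [a], [r s g *m invmx (rho g)] has derivative [a g]
   at every [g] as soon as it does at the generators, by the cocycle rule. *)
Lemma tangent_curve rho a (g1 g2 : pi) : free_on g1 g2 -> representation rho ->
    cocycle rho a ->
  exists r, curve_with_tangent rho a r /\
    forall g, is_derive (0 : C) (1 : C) (fun s => \tr (r s g) : C) (\tr (a g *m rho g)).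
Proof.
move=> hfree hr ha; have [dr rM] := hr; have [ta aM] := ha.
have uR g := rep_unit g hr.
(* Matrices of determinant other than 1 are sent to the identity; for [sl2_path] this can only
   happen away from [s = 0]. *)
pose sl (A : 'M[C]_2) : SLmx C 2 := insubd (1%g : SLmx C 2) A.
have slK (A : 'M[C]_2) : \det A = 1 -> val (sl A) = A.
  by move=> dA; rewrite insubdK //; apply/eqP.
pose h s g : SLmx C 2 := (sl (sl2_path (a g) s) * sl (rho g))%g.
have /choice[r0 r0P] : forall s, exists f : pi -> SLmx C 2,
    [/\ {morph f : x y / (x * y)%g}, f g1 = h s g1 & f g2 = h s g2].
  by move=> s; have [] := hfree (SLmx C 2) (h s g1) (h s g2).
pose r s g : 'M[C]_2 := val (r0 s g).
have rep_r s : representation (r s).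
  split=> [g|x y]; first exact/eqP/(valP (r0 s g)).
  by rewrite /r; have [-> _ _] := r0P s.
have r_0 : r 0 = rho.
  have [r0M r01 r02] := r0P 0; apply/funext => g; rewrite -[RHS]slK ?dr //.
  have h0 x : h 0 x = sl (rho x).
    by apply/val_inj; rewrite /= !slK ?sl2_path0 ?det1 ?mul1mx.
  congr val; apply: ((hfree (SLmx C 2) 1%g 1%g).2 (r0 0) (fun x => sl (rho x))).
  - exact: r0M.
  - by move=> x y; apply/val_inj; rewrite /= !slK ?rM // det_mulmx !dr mulr1.
  - by rewrite r01 h0.
  - by rewrite r02 h0.
have der g : entrywise_derive (fun s => r s g *m invmx (rho g)) (a g).
  have gen x : (forall s, r0 s x = h s x) ->
      entrywise_derive (fun s => r s x *m invmx (rho x)) (a x).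
    move=> rx i j; apply: near_eq_is_derive (entrywise_derive_sl2_path (ta x) i j).
    near=> s; rewrite /r rx /= !slK ?dr // -?mulmxA ?mulmxV ?mulmx1 //.
    by apply: det_sl2_path; near: s; exact: near0_addM_neq0.
  apply: (free_on_ind hfree (P := fun g => entrywise_derive
    (fun s => r s g *m invmx (rho g)) (a g))).
  - by apply: gen => s; have [] := r0P s.
  - by apply: gen => s; have [] := r0P s.
  (* With R(x) for [r s x *m invmx (rho x)], one has R(xy) = R(x) Ad(rho x)(R(y)), so the product
     rule gives the cocycle rule. *)
  - move=> x y dx dy.
    have := entrywise_derive_mulmx dx (entrywise_derive_mulmx
      (entrywise_derive_mulmx (entrywise_derive_cst (rho x)) dy)
      (entrywise_derive_cst (invmx (rho x)))).
    rewrite /= r_0 !mulmxV // !mulmx1 mulmxV // mulmx1 mul1mx add0r mulmx0 addr0.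
    rewrite -/(Ad _ _) -aM.
    congr (entrywise_derive _ _); apply/funext => s.
    rewrite rM (rep_r s).2 invmxM // !mulmxA.
    by rewrite -[_ *m invmx (rho x) *m rho x]mulmxA mulVmx // mulmx1.
  (* Here R(x^-1) is the conjugate by rho(x)^-1 of the inverse of R(x), written as [adj2]. *)
  - move=> x dx.
    have := entrywise_derive_mulmx (entrywise_derive_mulmx
      (entrywise_derive_cst (invmx (rho x))) (entrywise_derive_adj2 dx))
      (entrywise_derive_cst (rho x)).
    have -> : adj2 (a x) = - a x by rewrite /adj2 ta raddf0 sub0r.
    rewrite mul0mx add0r mulmx0 addr0 mulmxN mulNmx.
    have <- : a x^-1%g = - (invmx (rho x) *m a x *m rho x).
      by rewrite (cocycleV _ hr ha) /Ad invmxK.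
    congr (entrywise_derive _ _); apply/funext => s.
    rewrite (repV x hr) (repV x (rep_r s)) invmxK -invmx2; last first.
      by rewrite det_mulmx det_inv dr (rep_r s).1 invr1 mulr1.
    rewrite invmxM ?unitmx_inv ?uR ?rep_unit //.
    by rewrite invmxK !mulmxA mulVmx // mul1mx.
exists r; split; first split=> //.
- by near=> s; exact: rep_r.
- by move=> g; apply: is_derive_mx; exact: der.
move=> g.
have := is_derive_mxtrace
  (entrywise_derive_mulmx (der g) (entrywise_derive_cst (rho g))).
rewrite mulmx0 addr0; congr (is_derive _ _ _ _); apply/funext => s.
by rewrite -mulmxA mulVmx // mulmx1.
Unshelve. all: by end_near. Qed.

(** [is_differential] constrains [dt a] only along curves tangent to [a]; the one from
    [tangent_curve] determines it. *)
Lemma is_differential_trace rho dt a (g1 g2 g : pi) : free_on g1 g2 ->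
    representation rho -> is_differential (trace_fun g) rho dt -> cocycle rho a ->
  dt a = \tr (a g *m rho g).
Proof.
move=> hfree hr hdt ha; have [r [hc /(_ g) dtr]] := tangent_curve hfree hr ha.
have dtr' := hdt a ha r hc.
by rewrite -(@derive_val _ _ _ _ _ _ _ dtr') -(@derive_val _ _ _ _ _ _ _ dtr).
Qed.

End Cocycles.

(** * The symplectic form in trace coordinates *)

Section SymplecticForm.
Context (C : numClosedFieldType) (pi : groupType) (g1 g2 : pi).
Local Notation c := (peripheral g1 g2).
Implicit Types rho a b u : pi -> 'M[C]_2.

Lemma in_cycle_gen (p : pi) : in_cycle p p.
Proof. by exists 1%N; left; rewrite expg1. Qed.

(** The cocycle rules reduce this to the invariance of the trace form under [Ad]. *)
Lemma cup_cocycle rho u b g h k : representation rho -> cocycle rho u ->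
    cocycle rho b ->
  cup rho u b (h, k) - cup rho u b ((g * h)%g, k) + cup rho u b (g, (h * k)%g)
    - cup rho u b (g, h) = 0.
Proof.
move=> hr [_ uM] [_ bM]; rewrite /cup /= uM bM /form_B hr.2 Ad_mul ?rep_unit //.
have conj X Y : \tr (Ad (rho g) X *m Ad (rho g) Y) = \tr (X *m Y).
  rewrite /Ad !mulmxA -[_ *m invmx (rho g) *m rho g]mulmxA mulVmx ?rep_unit //.
  by rewrite mulmx1 mxtrace_mulC !mulmxA mulVmx ?rep_unit // mul1mx.
rewrite AdD mulmxDl mulmxDr !mxtraceD conj; ring.
Qed.

Lemma pairing_commutator_chain rho u b : representation rho ->
    rel_cocycle c rho u ->
  duality_pairing (commutator_chain g1 g2) rho u b =
  - (\tr (u g1 *m Ad (rho g1) (b g2)) - \tr (u g2 *m Ad (rho g2) (b g1))).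
Proof.
move=> hr [_ u0]; rewrite /duality_pairing -/(eval_cochain _ _).
rewrite eval_commutator_chain; first by rewrite /cup /form_B /= opprB opprK addrC.
by move=> x /u0 ux; rewrite /cup ux /form_B mul0mx mxtrace0 oppr0.
Qed.

(** Both sides evaluate [a] on g1 g2 = c g2 g1. *)
Lemma cocycle_commutator rho a : representation rho -> cocycle rho a ->
  a g1 + Ad (rho g1) (a g2) = a c + Ad (rho c) (a g2 + Ad (rho g2) (a g1)).
Proof. by move=> hr [_ aM]; rewrite -!aM peripheralK. Qed.

Lemma symplectic_commutator_chain rho a b u
    (D := trace_fun (g1 * g2)%g rho - trace_fun (g1 * g2^-1)%g rho) :
    free_on g1 g2 -> representation rho -> good rho -> D != 0 ->
    tangent_cocycle c rho b -> rel_cocycle c rho u ->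
  duality_pairing (commutator_chain g1 g2) rho u b =
  - (2 / D * (\tr (u g1 *m rho g1) * \tr (b g2 *m rho g2) -
              \tr (b g1 *m rho g1) * \tr (u g2 *m rho g2))).
Proof.
move=> hfree hr hgood D0 [hb [Y [_ bY]]] hu; have [[tu _] u0] := hu.
have uR g := rep_unit g hr; have [dr rM] := hr.
have cAB : rho c *m (rho g2 *m rho g1) = rho g1 *m rho g2.
  by rewrite -!rM peripheralK.
rewrite pairing_commutator_chain //; congr (- _).
have DE : D = \tr (rho g1 *m rho g2) - \tr (rho g1 *m invmx (rho g2)).
  by rewrite /D /trace_fun !rM repV.
(* [P] and [Q] are the derivatives of [A] and [B], that is, the values of [u] multiplied by those of
   [rho]. *)
have := @goldman_form_trace _ (rho g1) (rho g2) (u g1 *m rho g1) (u g2 *m rho g2)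
  (b g1) (b g2) Y (rho c).
rewrite -DE /Ad !mulmxA; apply => //.
- exact: good_comm2.
- by rewrite -mulmxA.
- by rewrite -mulmxA mulmxV // mulmx1.
- by rewrite -mulmxA mulmxV // mulmx1.
- have := cocycle_commutator hr hu.1; rewrite (u0 c (in_cycle_gen c)) add0r /Ad.
  move/(congr1 (mulmx^~ (rho g1 *m rho g2))).
  rewrite -{2}cAB mulmxDl -!mulmxA (mulKmx (uR g1)) (mulKmx (uR c)).
  rewrite mulmxDl -!mulmxA (mulKmx (uR g2)); exact.
- exact: hb.1.
- exact: hb.1.
- have := cocycle_commutator hr hb; rewrite (bY c (in_cycle_gen c)) /coboundary /Ad.
  exact.
Qed.

(** The sign comes from [z] alone, through [n], so it is fixed before [rho]; the minus sign in
    [- n%:~R] is that of [form_B]. *)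
Lemma symplectic_value_fundamental (z : {freeg (pi * pi)}) :
    free_on g1 g2 -> fundamental_cycle c z ->
  exists eps : C, (eps = 1 \/ eps = -1) /\
    forall rho, representation rho -> good rho ->
      trace_fun (g1 * g2)%g rho <> trace_fun (g1 * g2^-1)%g rho ->
    forall dt1 dt2, is_differential (trace_fun g1) rho dt1 ->
      is_differential (trace_fun g2) rho dt2 ->
    forall a b, tangent_cocycle c rho a -> tangent_cocycle c rho b ->
    symplectic_value c z rho a b (eps * (2 * (wedge dt1 dt2 a b /
      (trace_fun (g1 * g2)%g rho - trace_fun (g1 * g2^-1)%g rho)))).
Proof.
move=> hfree hz; have [n [n1 zn]] := fundamental_commutator_chain hfree hz.
exists (- n%:~R); split; first by case: n1 => ->; [right|left]; rewrite ?opprK.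
move=> rho hr hgood /eqP; rewrite -subr_eq0 => D0 dt1 dt2 hdt1 hdt2 a b ha hb.
have [ca [X [tX aX]]] := ha.
split.
  (* The lift subtracts the coboundary that [a] equals on the peripheral subgroup. *)
  exists (fun g => a g - coboundary rho X g); split.
    split; first exact: cocycle_sub_coboundary.
    by move=> p /aX ->; rewrite subrr.
  exists (- X); split=> [|g]; first by rewrite mxtraceN tX oppr0.
  by rewrite /coboundary AdN addrC addKr opprB opprK addrC.
move=> u hu [W [tW uaW]]; have [cu u0] := hu.
(* Coboundaries do not change trace derivatives, so any lift [u] has those of [a]. *)
have tua g : \tr (u g *m rho g) = \tr (a g *m rho g).
  apply/eqP; rewrite -subr_eq0 -mxtraceB -mulmxBl uaW.
  by rewrite mxtrace_coboundary_mul.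
have pairing_n : duality_pairing (commutator_chain g1 g2) rho u b =
    duality_pairing z rho u b *~ n.
  have cup0 x : in_cycle c x.1 -> cup rho u b x = 0.
    by move=> /u0 ux; rewrite /cup ux /form_B mul0mx mxtrace0 oppr0.
  rewrite /duality_pairing -!/(eval_cochain _ _).
  rewrite (eval_rel_homologous2 _ _ zn) ?raddfMz //.
    by move=> g h k; exact: cup_cocycle hr cu hb.1.
  by move=> x /cup0.
(* As [n] is 1 or -1, it is its own inverse. *)
have {pairing_n} -> : duality_pairing z rho u b =
    n%:~R * duality_pairing (commutator_chain g1 g2) rho u b.
  by rewrite pairing_n -(mulrzr (duality_pairing z rho u b)); case: n1 => ->; ring.
rewrite symplectic_commutator_chain // /wedge.
rewrite !(is_differential_trace hfree hr hdt1) //; try exact: hb.1.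
rewrite !(is_differential_trace hfree hr hdt2) //; try exact: hb.1.
rewrite !tua; ring.
Qed.

End SymplecticForm.

Theorem proposition41 (R : realType) (pi : groupType) (g1 g2 : pi)
    (hfree : free_on g1 g2)
    (z : {freeg (pi * pi)}) (hz : fundamental_cycle (peripheral g1 g2) z) :
  exists eps : R[i], (eps = 1 \/ eps = -1) /\
  forall rho0 : pi -> 'M[R[i]]_2,
    representation rho0 -> good rho0 ->
    boundary_regular (peripheral g1 g2) rho0 ->
    trace_fun (g1 * g2)%g rho0 <> trace_fun (g1 * g2^-1)%g rho0 ->
  forall rho : pi -> 'M[R[i]]_2,
    relative_rep (peripheral g1 g2) rho0 rho ->
    trace_fun (g1 * g2)%g rho <> trace_fun (g1 * g2^-1)%g rho ->
  forall dt1 dt2 : (pi -> 'M[R[i]]_2) -> R[i],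
    is_differential (trace_fun g1) rho dt1 ->
    is_differential (trace_fun g2) rho dt2 ->
  forall a b : pi -> 'M[R[i]]_2,
    tangent_cocycle (peripheral g1 g2) rho a ->
    tangent_cocycle (peripheral g1 g2) rho b ->
    symplectic_value (peripheral g1 g2) z rho a b
      (eps * (2 * (wedge dt1 dt2 a b /
         (trace_fun (g1 * g2)%g rho - trace_fun (g1 * g2^-1)%g rho)))).
Proof.
have [eps [eps1 value]] := symplectic_value_fundamental R[i] hfree hz.
exists eps; split=> // _ _ _ _ _ rho [hr hgood _] D0 dt1 dt2 hdt1 hdt2 a b ha hb.
exact: value.
Qed.
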